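(* If the real numbers $\alpha,\beta,\gamma,\delta$ are successive terms (in this order) of a harmonic progression, then $$3(\beta-\alpha)(\delta-\gamma)=(\gamma-\beta)(\delta-\alpha).$$
   Context: A sequence of (necessarily nonzero) real numbers $a_1,a_2,\ldots$ is a harmonic progression if the sequence of reciprocals $\frac1{a_1},\frac1{a_2},\ldots$ is an arithmetic progression, i.e. there is a fixed real $d$ with $\frac{1}{a_{n+1}}=\frac1{a_n}+d$ for all $n$. *)

(* Defs.v *)
From Stdlib Require Import Reals.
Open Scope R_scope.

Definition arithmetic_progression (b : nat -> R) : Prop :=
  exists d : R, forall n : nat, b (S n) = b n + d.

(* In Stdlib [/ 0] is a real number, so nonvanishing must be required
   explicitly. *)
Definition harmonic_progression (a : nat -> R) : Prop :=
  (forall n : nat, a n <> 0) /\ arithmetic_progression (fun n => 1 / a n).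

(* Main.v *)
Require Import Defs.
From Stdlib Require Import Reals Lra.
Open Scope R_scope.

(** Let [d] be the common difference of the reciprocals. A difference of two
    terms is their product times the opposite of the difference of their
    reciprocals ([sub_of_reciprocal_shift]). As the reciprocals of [alpha] and
    [delta] differ by [3 * d] and those of neighbours by [d], both sides equal
    [3 * d ^ 2 * alpha * beta * gamma * delta]. *)

Lemma sub_of_reciprocal_shift (x y e : R) :
  x <> 0 -> y <> 0 -> 1 / y = 1 / x + e -> y - x = - e * (x * y).
Proof.
  intros Hx Hy Hxy.
  replace e with (1 / y - 1 / x) by lra.
  field; auto.
Qed.

Theorem mainTheorem3 (alpha beta gamma delta : R)
  (H : exists (a : nat -> R) (n : nat),
      harmonic_progression a /\
      alpha = a n /\ beta = a (n + 1)%nat /\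
      gamma = a (n + 2)%nat /\ delta = a (n + 3)%nat) :
  3 * (beta - alpha) * (delta - gamma) = (gamma - beta) * (delta - alpha).
Proof.
  destruct H as (a & n & [Hnz [d Hd]] & -> & -> & -> & ->).
  rewrite !(Nat.add_comm n); simpl.
  pose proof (Hd n) as H1.
  pose proof (Hd (S n)) as H2.
  pose proof (Hd (S (S n))) as H3.
  cbv beta in H1, H2, H3.
  rewrite (sub_of_reciprocal_shift (a n) (a (S n)) d) by auto.
  rewrite (sub_of_reciprocal_shift (a (S n)) (a (S (S n))) d) by auto.
  rewrite (sub_of_reciprocal_shift (a (S (S n))) (a (S (S (S n)))) d) by auto.
  rewrite (sub_of_reciprocal_shift (a n) (a (S (S (S n)))) (3 * d))
    by (auto; lra).
  ring.
Qed.
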